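(* Let $A=\{a_1,\dots,a_K\}$ be a finite set of items, let $\mathcal{F}$ be an antimonotonic family of itemsets over $A$, let $\theta$ be frequencies for $\mathcal{F}$, and let $C\subseteq A$ be a safe set. Let $p^{ME}$ be the maximum entropy distribution on $\{0,1\}^K$ satisfying $\theta$, and let $q^{ME}$ be the maximum entropy distribution on $\{0,1\}^C$ satisfying $\pi_C\theta$. Then $q^{ME}=\pi_C p^{ME}$.
   Context: An itemset is a subset $U\subseteq A$ with indicator $S_U:\{0,1\}^K\to\{0,1\}$, $S_U(z)=1$ iff $z_i=1$ for all $a_i\in U$. $\mathcal{F}$ is antimonotonic if it is closed under taking subsets. A distribution $p$ on $\{0,1\}^K$ satisfies $\theta=(\theta_U)_{U\in\mathcal{F}}$ if $E_p[S_U]=\theta_U$ for all $U\in\mathcal{F}$; ''frequencies for $\mathcal{F}$'' means such a $\theta$ satisfied by at least one distribution. For $C\subseteq A$, $\pi_C\mathcal{F}=\{U\in\mathcal{F}:U\subseteq C\}$, $\pi_C\theta=(\theta_U)_{U\in\pi_C\mathcal{F}}$, $\pi_C p$ is the marginal of $p$ on the coordinates in $C$, $p$ is an extension of $q$ if $\pi_Cp=q$, and a distribution $q$ on $\{0,1\}^C$ satisfies $\pi_C\theta$ if $E_q[S_U]=\theta_U$ for $U\in\pi_C\mathcal{F}$. $C$ is safe if for every frequencies $\theta'$ for $\mathcal{F}$, every distribution $q$ on $\{0,1\}^C$ satisfying $\pi_C\theta'$ has an extension $p$ on $\{0,1\}^K$ satisfying $\theta'$. The entropy of a distribution $p$ is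 $H(p)=-\sum_z p(z)\log p(z)$; the maximum entropy distribution satisfying given constraints is the (unique) feasible distribution maximising $H$. *)

(* Defs.v *)
From mathcomp Require Import all_boot all_order all_algebra.
From mathcomp Require Import reals exp.

Set Implicit Arguments.
Unset Strict Implicit.
Unset Printing Implicit Defensive.

Import Order.TTheory GRing.Theory Num.Theory.
Local Open Scope ring_scope.

(* {0,1}^I, for a finite type I of items. *)
Notation cube I := {ffun I -> bool}.

(* A set C of items seen as a type, so that {0,1}^C is cube (items C). *)
Notation items C := {i | i \in C}.

Definition is_distr (R : realType) (X : finType) (p : {ffun X -> R}) : Prop :=
  (forall x, 0 <= p x) /\ \sum_x p x = 1.

Definition expect (R : realType) (X : finType) (p : {ffun X -> R})
  (f : X -> R) : R := \sum_x p x * f x.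

(* The convention 0 log 0 = 0 holds here, since 0 * ln 0 = 0. *)
Definition entropy (R : realType) (X : finType) (p : {ffun X -> R}) : R :=
  - \sum_x p x * ln (p x).

Definition is_max_entropy (R : realType) (X : finType)
    (sat : {ffun X -> R} -> Prop) (p : {ffun X -> R}) : Prop :=
  [/\ is_distr p, sat p &
      forall p', is_distr p' -> sat p' -> entropy p' <= entropy p].

Definition indic (I : finType) (U : {set I}) (z : cube I) : bool :=
  [forall i in U, z i].

Definition antimonotonic (A : finType) (F : {set {set A}}) : Prop :=
  forall U V : {set A}, V \in F -> U \subset V -> U \in F.

(* A vector (theta_U)_{U in F} is represented by a total function on itemsets
   of which only the values on F are ever used; pi_C theta is then the same
   function, read on the smaller family pi_C F. *)
Definition satisfies (R : realType) (A : finType) (F : {set {set A}})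
    (theta : {set A} -> R) (p : {ffun cube A -> R}) : Prop :=
  forall U, U \in F -> expect p (fun z => (indic U z)%:R) = theta U.

Definition frequencies (R : realType) (A : finType) (F : {set {set A}})
    (theta : {set A} -> R) : Prop :=
  exists p : {ffun cube A -> R}, is_distr p /\ satisfies F theta p.

Definition proj_family (A : finType) (C : {set A}) (F : {set {set A}}) :
    {set {set A}} :=
  [set U in F | U \subset C].

(* An itemset U included in C, as a set of elements of the type items C. *)
Definition in_items (A : finType) (C U : {set A}) : {set items C} :=
  [set i | val i \in U].

Definition proj_satisfies (R : realType) (A : finType) (C : {set A})
    (F : {set {set A}}) (theta : {set A} -> R)
    (q : {ffun cube (items C) -> R}) : Prop :=
  forall U, U \in proj_family C F ->
    expect q (fun z => (indic (in_items C U) z)%:R) = theta U.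

Definition restrict (A : finType) (C : {set A}) (z : cube A) :
    cube (items C) :=
  [ffun i => z (val i)].

Definition marginal (R : realType) (A : finType) (C : {set A})
    (p : {ffun cube A -> R}) : {ffun cube (items C) -> R} :=
  [ffun y => \sum_(z | restrict C z == y) p z].

Definition extension (R : realType) (A : finType) (C : {set A})
    (p : {ffun cube A -> R}) (q : {ffun cube (items C) -> R}) : Prop :=
  marginal C p = q.

Definition safe (R : realType) (A : finType) (F : {set {set A}})
    (C : {set A}) : Prop :=
  forall theta' : {set A} -> R, frequencies F theta' ->
  forall q : {ffun cube (items C) -> R},
    is_distr q -> proj_satisfies F theta' q ->
    exists p : {ffun cube A -> R},
      [/\ is_distr p, satisfies F theta' p & extension p q].

(* Main.v *)
(* Join two items outside C when they lie in a common member of F, and let B be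
   a connected component of the resulting graph and T the set of items of C
   sharing a member of F with B.  If T were nonempty and not in F, perturbing
   the uniform distribution on {0,1}^C by the parity on T would change no
   frequency in pi_C F; but the pairs in F can force all items of B to equal the
   conjunction over T, whose frequency does change, so C would not be safe.
   Hence the frequencies determine the marginal on T, and in any distribution
   satisfying theta the coordinates in B may be redrawn from the conditional law
   of pME given T without changing any frequency.  Start from an extension of
   qME and redraw every component: by Gibbs' inequality each step adds at least
   as much entropy as the same coordinates contribute to pME.  Since pME is
   maximal, H(qME) <= H(pi_C pME), and strict concavity of entropy concludes. *)
Require Import Defs.
From mathcomp Require Import all_boot all_order all_algebra.
From mathcomp Require Import reals exp.
From mathcomp Require Import ring lra.

Set Implicit Arguments.
Unset Strict Implicit.
Unset Printing Implicit Defensive.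

Import Order.TTheory GRing.Theory Num.Theory.
Local Open Scope ring_scope.

(** * Strict concavity of entropy and uniqueness of its maximiser *)

Section Entropy.
Variable R : realType.

(** The tangent bound [ln t <= t - 1] at [t = b / a], scaled by [a]. Its equality case is what
    yields uniqueness of the maximiser. *)
Lemma ln_leif (a b : R) : 0 <= a -> 0 <= b -> (0 < a -> 0 < b) ->
  a * ln b - a * ln a <= b - a ?= iff (a == b).
Proof.
rewrite le0r => /orP[/eqP-> b_ge0 _|a_gt0 _ /(_ a_gt0) b_gt0].
  rewrite !mul0r subrr subr0; split=> //.
have [->|neq_ab] := eqVneq a b.
  by rewrite !subrr; split; rewrite // eqxx.
have t_neq0 : ln (b / a) != 0.
  rewrite ln_eq0 ?divr_gt0 //; apply: contra neq_ab => /eqP/divr1_eq->.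
  exact: eqxx.
have lt_ab : a * ln b - a * ln a < b - a.
  rewrite -mulrBr -ln_div ?posrE //.
  have := expR_gt1Dx t_neq0; rewrite lnK ?posrE ?divr_gt0 //.
  by rewrite ltr_pdivlMr //; lra.
by apply/leifP; rewrite ?(negPf neq_ab).
Qed.

(** The tangent bounds of [p] and [q] against their midpoint [r] have right-hand sides summing to 0.
    Maximality makes the left-hand sides sum to at least 0, so every bound is an equality and
    [p = r = q]. *)
Lemma is_max_entropy_uniq (X : finType) (sat : {ffun X -> R} -> Prop)
    (p q : {ffun X -> R}) :
  (forall p' q' : {ffun X -> R}, sat p' -> sat q' ->
    sat [ffun x => (p' x + q' x) / 2]) ->
  is_max_entropy sat p -> is_max_entropy sat q -> p = q.
Proof.
move=> sat_mid [[p_ge0 p1] satp maxp] [[q_ge0 q1] satq maxq].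
pose r := [ffun x => (p x + q x) / 2].
have r_distr : is_distr r.
  split=> [x|]; first by rewrite ffunE divr_ge0 ?addr_ge0.
  under eq_bigr do rewrite ffunE.
  by rewrite -mulr_suml big_split /= p1 q1; lra.
have Hr : entropy r <= entropy p by exact: maxp (sat_mid _ _ satp satq).
have Hpq : entropy q = entropy p.
  by apply/eqP; rewrite eq_le maxp ?maxq.
have le_x x : (p x * ln (r x) - p x * ln (p x)) +
    (q x * ln (r x) - q x * ln (q x)) <= (r x - p x) + (r x - q x)
    ?= iff ((p x == r x) && (q x == r x)).
  have := (p_ge0 x, q_ge0 x); rewrite /r ffunE => -[px qx].
  by apply: leifD; apply: ln_leif => [||px_gt0]; lra.
have sumr0 : \sum_x ((r x - p x) + (r x - q x)) = 0.
  by apply: big1 => x _; rewrite ffunE; field.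
have sum_ge0 : 0 <= \sum_x ((p x * ln (r x) - p x * ln (p x)) +
    (q x * ln (r x) - q x * ln (q x))).
  have -> : \sum_x ((p x * ln (r x) - p x * ln (p x)) +
    (q x * ln (r x) - q x * ln (q x))) =
    entropy p + entropy q - 2 * entropy r.
    rewrite /entropy mulrN opprK mulr_sumr -!sumrN -!big_split /=.
    by apply: eq_bigr => x _; move: (ln (r x)) => l; rewrite ffunE; field.
  by rewrite Hpq; lra.
have := leif_sum (fun x (_ : xpredT x) => le_x x) => -[].
rewrite sumr0 => le0; rewrite eq_le le0 sum_ge0 => /esym/forall_inP eq_x.
by apply/ffunP => x; have /andP[/eqP-> /eqP->] := eq_x x isT.
Qed.

End Entropy.

(** * Image distributions *)

Section Pushforward.
Variables (R : realType) (X Y : finType) (phi : X -> Y).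
Implicit Type p : {ffun X -> R}.

Definition push p : {ffun Y -> R} := [ffun y => \sum_(x | phi x == y) p x].

Lemma expect_push p (f : Y -> R) : expect (push p) f = expect p (f \o phi).
Proof.
rewrite /expect (partition_big phi xpredT) //=.
apply: eq_bigr => y _; rewrite ffunE mulr_suml.
by apply: eq_bigr => x /eqP<-.
Qed.

Lemma is_distr_push p : is_distr p -> is_distr (push p).
Proof.
move=> [p0 p1]; split=> [y|]; first by rewrite ffunE sumr_ge0.
rewrite -p1 (partition_big phi xpredT) //=.
by apply: eq_bigr => y _; rewrite ffunE.
Qed.

End Pushforward.

(** * Marginals, their entropy and their moments *)

Section Marginals.
Variables (R : realType) (A : finType).
Implicit Types (X Y D U : {set A}) (z w : cube A) (p : {ffun cube A -> R}).

Lemma restrict_eqP X z w :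
  reflect {in X, z =1 w} (restrict X z == restrict X w).
Proof.
apply: (iffP eqP) => [/ffunP eq_zw i Xi|eq_zw].
  by have := eq_zw (exist _ i Xi); rewrite !ffunE.
by apply/ffunP => -[i Xi]; rewrite !ffunE eq_zw.
Qed.

(** Any section of [restrict X] would do; the value [false] outside [X] is arbitrary. *)
Definition unrestrict X (y : cube (items X)) : cube A :=
  [ffun i => if insub i is Some j then y j else false].

Lemma unrestrictE X (y : cube (items X)) (j : items X) :
  unrestrict y (val j) = y j.
Proof. by rewrite ffunE valK. Qed.

Lemma unrestrictK X : cancel (@unrestrict X) (@restrict A X).
Proof. by move=> y; apply/ffunP => j; rewrite ffunE unrestrictE. Qed.

Lemma unrestrict_in X z : {in X, unrestrict (restrict X z) =1 z}.
Proof.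
by move=> i Xi; rewrite (unrestrictE (restrict X z) (exist _ i Xi)) ffunE.
Qed.

Definition local_on X (f : cube A -> R) :=
  forall z w, {in X, z =1 w} -> f z = f w.

Lemma local_onS X Y f : X \subset Y -> local_on X f -> local_on Y f.
Proof.
by move=> /subsetP sXY fX z w eq_zw; apply: fX => i /sXY; apply: eq_zw.
Qed.

Lemma local_indic U X : U \subset X -> local_on X (fun z => (indic U z)%:R).
Proof.
move=> /subsetP sUX z w eq_zw; rewrite /indic; congr (nat_of_bool _)%:R.
by apply: eq_forallb => i; case: (boolP (i \in U)) => //= /sUX/eq_zw->.
Qed.

Lemma expect_marginal X p (f : cube (items X) -> R) :
  expect (marginal X p) f = expect p (f \o restrict X).
Proof. exact: expect_push. Qed.

Lemma expect_local X p q f : local_on X f -> marginal X p = marginal X q ->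
  expect p f = expect q f.
Proof.
move=> fX eq_pq.
have eqf p' : expect p' f = expect (marginal X p') (f \o @unrestrict X).
  rewrite expect_marginal; apply: eq_bigr => z _; congr (_ * _).
  by apply: fX => i Xi; rewrite unrestrict_in.
by rewrite !eqf eq_pq.
Qed.

(* The marginal of [p] on [X], read as a function on the whole cube. *)
Definition marg X p z : R := marginal X p (restrict X z).

Lemma margE X p z :
  marg X p z = \sum_(w | restrict X w == restrict X z) p w.
Proof. by rewrite /marg ffunE. Qed.

Lemma local_marg X p : local_on X (marg X p).
Proof. by move=> z w /restrict_eqP/eqP; rewrite /marg => ->. Qed.

Lemma marg_inj X p q : marg X p =1 marg X q -> marginal X p = marginal X q.
Proof.
move=> eq_pq; apply/ffunP=> y.
by have := eq_pq (unrestrict y); rewrite /marg unrestrictK.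
Qed.

Lemma margT p : marg setT p =1 p.
Proof.
move=> z; rewrite margE (big_pred1 z) // => w /=.
apply/restrict_eqP/eqP => [eq_wz|-> //].
by apply/ffunP => i; apply: eq_wz.
Qed.

(** After exchanging sums, [p v] is counted once for each [w] agreeing with [z] on [X] and with [v]
    on [Y]: one gluing if [z] and [v] agree on [X :&: Y], none otherwise. *)
Lemma sum_marg X Y p z : X :|: Y = setT ->
  \sum_(w | restrict X w == restrict X z) marg Y p w = marg (X :&: Y) p z.
Proof.
move=> XY; rewrite margE.
under eq_bigr do rewrite margE.
rewrite (exchange_big_dep xpredT) //= [RHS]big_mkcond /=.
apply: eq_bigr => v _.
case: restrict_eqP => [eq_vz|neq_vz].
  rewrite (big_pred1 [ffun i => if i \in X then z i else v i]) // => w /=.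
  apply/andP/eqP => [[/restrict_eqP wz /restrict_eqP vw]|->].
    apply/ffunP => i; rewrite ffunE; case: ifPn => [/wz //|Xi].
    by rewrite vw //; have := in_setT i; rewrite -XY inE (negPf Xi).
  split; apply/restrict_eqP => i; rewrite ffunE; first by move=> ->.
  by case: ifP => // Xi Yi; rewrite eq_vz // inE Xi Yi.
rewrite big_pred0 // => w.
apply/negP => /andP[/restrict_eqP wz /restrict_eqP vw].
by apply: neq_vz => i; rewrite inE => /andP[Xi Yi]; rewrite vw ?wz.
Qed.

Lemma marg_ge0 X p z : is_distr p -> 0 <= marg X p z.
Proof. by move=> [p0 _]; rewrite margE sumr_ge0. Qed.

Lemma margS X Y p z : is_distr p -> X \subset Y -> marg Y p z <= marg X p z.
Proof.
move=> [p0 _] /subsetP sXY; rewrite !margE big_mkcond [leRHS]big_mkcond /=.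
apply: ler_sum => w _; case: restrict_eqP => [wz|_]; last by case: ifP.
by case: restrict_eqP => // -[] i /sXY; apply: wz.
Qed.

Lemma le_marg X p z : is_distr p -> p z <= marg X p z.
Proof. by move=> dp; rewrite -(margT p z) margS ?subsetT. Qed.

Lemma is_distr_marginal X p : is_distr p -> is_distr (marginal X p).
Proof. exact: is_distr_push. Qed.

(** Written as an expectation over the whole cube, so that different [X] can be compared under one
    distribution. *)
Definition entropy_on X p : R := - expect p (fun z => ln (marg X p z)).

Lemma entropy_onT p : entropy_on setT p = entropy p.
Proof. by congr (- _); apply: eq_bigr => z _; rewrite margT. Qed.

Lemma entropy_onE X p : entropy_on X p = entropy (marginal X p).
Proof.
rewrite /entropy_on /entropy; congr (- _).
by rewrite -[RHS]/(expect (marginal X p) (fun y => ln (marginal X p y)))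
  expect_marginal.
Qed.

Lemma gibbs X p q : is_distr p -> is_distr q ->
  (forall z, 0 < p z -> 0 < marg X q z) ->
  entropy_on X p <= - expect p (fun z => ln (marg X q z)).
Proof.
move=> dp dq q_gt0; rewrite lerN2 -subr_le0 /expect -sumrB.
have [p0 p1] := dp; have [q0 q1] := dq.
apply: (@le_trans _ _ (\sum_z (p z * (marg X q z / marg X p z) - p z))).
  apply: ler_sum => z _.
  have := p0 z; rewrite le0r => /orP[/eqP->|pz]; first by rewrite !mul0r subrr.
  have mp : 0 < marg X p z by apply: lt_le_trans pz (le_marg _ _ dp).
  have [+ _] := ln_leif (ltW mp) (marg_ge0 X z dq) (fun _ => q_gt0 z pz).
  move=> le_ln.
  have le1 : ln (marg X q z) - ln (marg X p z) <= marg X q z / marg X p z - 1.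
    rewrite -(ler_pM2l mp) mulrBr (le_trans le_ln) // mulrBr mulr1.
    by rewrite mulrCA divff ?mulr1 // lt0r_neq0.
  by have := ler_wpM2l (ltW pz) le1; rewrite !mulrBr mulr1.
rewrite sumrB p1 subr_le0 -q1.
(* [marg X q z] is spread over the points [w] of its fibre; summing over [z] first cancels
   [marg X p w] and leaves at most [q w]. *)
pose f z w :=
  if restrict X w == restrict X z then p z * (q w / marg X p w) else 0.
rewrite (_ : \sum_z _ = \sum_z \sum_w f z w); last first.
  apply: eq_bigr => z _.
  rewrite [marg X q z]margE mulr_suml mulr_sumr big_mkcond.
  apply: eq_bigr => w _; rewrite /f; case: eqP => // e.
  by rewrite /marg e.
rewrite exchange_big /=; apply: ler_sum => w _.
rewrite /f -big_mkcond /= -mulr_suml.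
rewrite (eq_bigl (fun z => restrict X z == restrict X w)); last first.
  by move=> z; rewrite eq_sym.
rewrite -margE; have := marg_ge0 X w dp; rewrite le0r => /orP[/eqP->|mp].
  by rewrite mul0r.
by rewrite mulrCA divff ?mulr1 // lt0r_neq0.
Qed.

(** Inclusion-exclusion: the event of ones on [P] and zeros on [N] is a difference of two events
    with one zero fewer, one of them having a one in its place. Induction on [#|N|] ends at
    itemsets, and the atoms of the marginal are such events. *)
Lemma marginal_eq_moments X p q :
  (forall U, U \subset X ->
    expect p (fun z => (indic U z)%:R) = expect q (fun z => (indic U z)%:R)) ->
  marginal X p = marginal X q.
Proof.
move=> eq_mom.
pose ev (P N : {set A}) z := indic P z && [forall i in N, ~~ z i].
have eq_ev n : forall P N : {set A}, (#|N| = n)%N -> P :|: N \subset X ->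
    expect p (fun z => (ev P N z)%:R) = expect q (fun z => (ev P N z)%:R).
  elim: n => [|n IH] P N cardN sPN.
    have N0 : N = set0 by apply/eqP; rewrite -cards_eq0 cardN.
    have evE z : ev P N z = indic P z.
      by rewrite /ev N0 andbC; case: forall_inP => // -[] i; rewrite inE.
    rewrite /expect; under eq_bigr do rewrite evE.
    under [RHS]eq_bigr do rewrite evE.
    by apply: eq_mom; apply: subset_trans sPN; rewrite subsetUl.
  have [i Ni] : exists i, i \in N by apply/card_gt0P; rewrite cardN.
  have evE z : (ev P N z)%:R =
      (ev P (N :\ i) z)%:R - (ev (i |: P) (N :\ i) z)%:R :> R.
    have -> : ev P N z = ev P (N :\ i) z && ~~ z i.
      rewrite /ev -andbA; congr (_ && _).
      apply/forall_inP/andP => [h|[/forall_inP h zi] j Nj].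
        by split; [apply/forall_inP=> j /setD1P[_] |]; apply: h.
      have [-> //|ji] := eqVneq j i; apply: h; exact/setD1P.
    have -> : ev (i |: P) (N :\ i) z = ev P (N :\ i) z && z i.
      rewrite /ev andbAC; congr (_ && _).
      apply/forall_inP/andP => [h|[/forall_inP h zi] j].
        by split; [apply/forall_inP=> j Pj|]; apply: h;
          rewrite !inE ?Pj ?eqxx ?orbT.
      by case/setU1P=> [-> //|]; apply: h.
    by case: (ev P _ z); case: (z i); rewrite /= ?subrr ?subr0.
  have EE (r : {ffun cube A -> R}) : expect r (fun z => (ev P N z)%:R) =
     expect r (fun z => (ev P (N :\ i) z)%:R) -
     expect r (fun z => (ev (i |: P) (N :\ i) z)%:R).
    by rewrite /expect -sumrB; apply: eq_bigr => z _; rewrite evE mulrBr.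
  have cardNi : #|N :\ i| = n by have := cardsD1 i N; rewrite Ni cardN => -[].
  rewrite !EE; congr (_ - _); apply: IH => //; apply: subset_trans sPN.
    by rewrite setUS // subD1set.
  apply/subsetP => j; rewrite !inE; case: eqP => [->|_]; rewrite ?Ni ?orbT //=.
apply: marg_inj => z.
pose P := [set i in X | z i]; pose N := [set i in X | ~~ z i].
have margEE (r : {ffun cube A -> R}) :
    marg X r z = expect r (fun z => (ev P N z)%:R).
  rewrite margE /expect big_mkcond; apply: eq_bigr => w _.
  have -> : (restrict X w == restrict X z) = ev P N w.
    apply/restrict_eqP/andP => [eq_wz|[/forall_inP Pw /forall_inP Nw] i Xi].
      by split; apply/forall_inP => i; rewrite inE => /andP[/eq_wz->].
    have := (Pw i, Nw i); rewrite !inE Xi /= => -[].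
    by case: (z i) => /= [-> //|_ /(_ isT)/negPf].
  by case: (ev P N w); rewrite ?mulr1 ?mulr0.
rewrite !margEE; apply: eq_ev erefl _.
by apply/subsetP => i; rewrite !inE; case: (i \in X).
Qed.

End Marginals.

(** * Redrawing a block of coordinates from a conditional law *)

Section Resample.
Variables (R : realType) (A : finType) (B T : {set A}).
Implicit Types (Y D : {set A}) (z w : cube A) (p q : {ffun cube A -> R}).

(* Redraw the coordinates in [B] of [q] from the conditional law of [p] given
   the coordinates in [T]; where that law is undefined the value is [0]. *)
Definition resample p q : {ffun cube A -> R} :=
  [ffun z => marg (~: B) q z * (marg (B :|: T) p z / marg T p z)].

(** Minus the conditional entropy, under [p], of the coordinates in [B] given those in [T]. *)
Definition resample_cost p : R :=
  expect p (fun z => ln (marg (B :|: T) p z)) -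
  expect p (fun z => ln (marg T p z)).

Hypothesis BT : [disjoint B & T].

(** The conditional factor depends only on [B :|: T], so it leaves the sum; [sum_marg] collapses the
    rest. *)
Lemma marg_resample Y p q z : [disjoint Y & B] -> T \subset Y ->
  marg (Y :|: B) (resample p q) z =
  marg Y q z * (marg (B :|: T) p z / marg T p z).
Proof.
move=> dYB sTY; rewrite margE.
under eq_bigr => w /restrict_eqP wz.
  rewrite ffunE (_ : marg (B :|: T) p w = marg (B :|: T) p z); last first.
    apply: local_marg => i Hi; apply: wz; move: i Hi; apply/subsetP.
    by rewrite setUC setSU.
  rewrite (_ : marg T p w = marg T p z); last first.
    by apply: local_marg => i Hi; apply: wz; rewrite inE (subsetP sTY).
  over.
rewrite -mulr_suml sum_marg; last first.
  by rewrite -setUA setUCr setUT.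
congr (marg _ q z * _); apply/setP => i; rewrite !inE.
by case: (boolP (i \in Y)) => [/(disjointFr dYB)->|_] //=; rewrite andbN.
Qed.

Lemma marg_resampleC p q z : is_distr p -> is_distr q ->
  marginal T p = marginal T q ->
  marg (~: B) (resample p q) z = marg (~: B) q z.
Proof.
move=> dp dq eqT; rewrite margE.
have sTB : T \subset ~: B by rewrite -disjoints_subset disjoint_sym.
under eq_bigr => w /restrict_eqP wz.
  rewrite ffunE (_ : marg (~: B) q w = marg (~: B) q z); last exact: local_marg.
  rewrite (_ : marg T p w = marg T p z); last first.
    by apply: local_marg => i Hi; apply: wz; rewrite (subsetP sTB).
  over.
rewrite -mulr_sumr -mulr_suml sum_marg; last first.
  by rewrite setUA [~: B :|: B]setUC setUCr setTU.
have -> : ~: B :&: (B :|: T) = T.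
  by rewrite setIUr [~: B :&: B]setIC setICr set0U; apply/setIidPr.
(* Where the quotient is [0 / 0 = 0], agreement on [T] gives [q] no mass either. *)
have [mT0|mT0] := eqVneq (marg T p z) 0; last by rewrite divff ?mulr1.
rewrite mT0 mul0r mulr0; apply/esym/eqP; rewrite eq_le marg_ge0 // andbT.
by rewrite -mT0 /marg eqT; apply: margS.
Qed.

Lemma marg_resampleBT p q : is_distr p ->
  marginal T p = marginal T q ->
  marginal (B :|: T) (resample p q) = marginal (B :|: T) p.
Proof.
move=> dp eqT; apply: marg_inj => z; rewrite [in LHS]setUC.
rewrite marg_resample //; last by rewrite disjoint_sym.
rewrite (_ : marg T q z = marg T p z); last by rewrite /marg eqT.
have [mT0|mT0] := eqVneq (marg T p z) 0; last by rewrite mulrCA divff ?mulr1.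
rewrite mT0 mul0r; apply/esym/eqP; rewrite eq_le marg_ge0 // andbT.
by rewrite -mT0; apply: margS => //; rewrite subsetUr.
Qed.

Lemma is_distr_resample p q : is_distr p -> is_distr q ->
  marginal T p = marginal T q -> is_distr (resample p q).
Proof.
move=> dp dq eqT; split=> [z|].
  by rewrite ffunE mulr_ge0 ?divr_ge0 ?marg_ge0.
have E (r : {ffun cube A -> R}) : \sum_w r w = expect r (fun=> 1 : R).
  by apply: eq_bigr => w _; rewrite mulr1.
rewrite E -[RHS](proj2 dq) E; apply: (@expect_local _ _ (~: B)) => //.
by apply: marg_inj => z; apply: marg_resampleC.
Qed.

(** The logarithm of [marg_resample], averaged under [r]. Leaving [r] free covers both
    [resample p q] and [p] itself. *)
Lemma expect_ln_marg_resample D p q r : is_distr p -> is_distr q ->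
  is_distr r -> marginal (B :|: T) r = marginal (B :|: T) p ->
  [disjoint D & B] -> T \subset D ->
  (forall z, 0 < r z -> 0 < marg D q z) ->
  expect r (fun z => ln (marg (D :|: B) (resample p q) z)) =
  expect r (fun z => ln (marg D q z)) + resample_cost p.
Proof.
move=> dp dq [r0 _] eqr dDB sTD rq.
have eqC : resample_cost p =
   expect r (fun z => ln (marg (B :|: T) p z)) -
   expect r (fun z => ln (marg T p z)).
  congr (_ - _); apply/esym/(expect_local _ eqr) => z w zw; congr ln.
    exact: local_marg zw.
  by apply: local_onS (local_marg (X := T) p) _ _ zw; rewrite subsetUr.
rewrite eqC /expect -sumrB -big_split /=; apply: eq_bigr => z _.
have := r0 z; rewrite le0r => /orP[/eqP->|rz]; first by rewrite !mul0r; ring.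
have pBT : 0 < marg (B :|: T) p z.
  rewrite /marg -eqr; apply: lt_le_trans rz _.
  by rewrite -/(marg _ r z) margE (bigD1 z) //= ler_wpDr // sumr_ge0.
have pT : 0 < marg T p z.
  by apply: lt_le_trans pBT (margS _ _ _); rewrite // subsetUr.
rewrite marg_resample // lnM ?posrE ?rq ?divr_gt0 // ln_div ?posrE //.
by rewrite mulrDr mulrBr.
Qed.

(** After resampling, adding [B] to [D] gains exactly the conditional entropy of [B] given [T] under
    [p]. Under [p] itself the gain is at most that, by [gibbs] against [resample p p], where [B]
    depends on [D] only through [T]. *)
Lemma entropy_on_resample D p q : is_distr p -> is_distr q ->
  marginal T p = marginal T q -> [disjoint D & B] -> T \subset D ->
  entropy_on (D :|: B) p - entropy_on D p <=
  entropy_on (D :|: B) (resample p q) - entropy_on D q.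
Proof.
move=> dp dq eqT dDB sTD.
have sDB : D \subset ~: B by rewrite -disjoints_subset.
have pos r z : is_distr r -> 0 < r z -> 0 < marg D r z.
  by move=> dr rz; apply: lt_le_trans rz (le_marg _ _ dr).
have dr := is_distr_resample dp dq eqT.
have eqC : marginal (~: B) (resample p q) = marginal (~: B) q.
  by apply: marg_inj => z; apply: marg_resampleC.
have eqD z : marg D (resample p q) z = marg D q z.
  rewrite !margE.
  have E (r' : {ffun cube A -> R}) :
      \sum_(w | restrict D w == restrict D z) r' w =
      expect r' (fun w => (restrict D w == restrict D z)%:R : R).
    rewrite /expect big_mkcond; apply: eq_bigr => w _.
    by case: eqP; rewrite ?mulr1 ?mulr0.
  rewrite !E; apply: expect_local eqC; apply: local_onS sDB _ => w w' ww'.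
  by congr (nat_of_bool (_ == _))%:R; apply/eqP/restrict_eqP.
have -> : entropy_on (D :|: B) (resample p q) =
    entropy_on D q - resample_cost p.
  rewrite /entropy_on expect_ln_marg_resample //.
  - rewrite opprD; congr (- _ - _); apply: expect_local eqC.
    by apply: local_onS sDB _ => w w' ww'; congr ln; apply: local_marg.
  - exact: marg_resampleBT.
  - by move=> z rz; rewrite -eqD; apply: pos.
have dpp := is_distr_resample dp dp erefl.
have : entropy_on (D :|: B) p <= entropy_on D p - resample_cost p.
  rewrite -opprD -(expect_ln_marg_resample (q := p) dp dp dp) //; last first.
    by move=> z; apply: pos.
  apply: gibbs => // z pz; rewrite marg_resample //.
  have pBT : 0 < marg (B :|: T) p z by apply: lt_le_trans pz (le_marg _ _ dp).
  rewrite mulr_gt0 ?pos // divr_gt0 //.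
  by apply: lt_le_trans pz (le_marg _ _ dp).
by lra.
Qed.

End Resample.

(** * Parity perturbations of the uniform distribution *)

Section Parity.
Variables (R : realType) (I : finType) (T : {set I}).
Implicit Types (y : cube I) (f : cube I -> R).

(** Zeros are counted rather than ones, so that the all-ones point has parity 1 whatever the size of
    [T]. *)
Definition parity y : R := (-1) ^+ (\sum_(i in T) ~~ y i).

(** Flipping the coordinate [i] is an involution that negates the parity and preserves [f]. *)
Lemma sum_parity_eq0 f i : i \in T ->
  (forall y y', (forall k, k != i -> y k = y' k) -> f y = f y') ->
  \sum_y parity y * f y = 0.
Proof.
move=> Ti fi.
pose flip y : cube I := [ffun k => if k == i then ~~ y k else y k].
have flipK : involutive flip.
  by move=> y; apply/ffunP => k; rewrite !ffunE; case: eqP; rewrite ?negbK.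
have eqN : \sum_y parity y * f y = - \sum_y parity y * f y.
  rewrite {1}(reindex_inj (inv_inj flipK)) /= -sumrN; apply: eq_bigr => y _.
  rewrite -mulNr; congr (_ * _); last first.
    by apply: fi => k /negPf ki; rewrite ffunE ki.
  rewrite /parity !(bigD1 i Ti) /= ffunE eqxx !exprD -mulNr; congr (_ * _).
    by case: (y i); rewrite /= ?expr0 ?expr1 ?opprK.
  by congr (_ ^+ _); apply: eq_bigr => k /andP[_ /negPf ki]; rewrite ffunE ki.
by lra.
Qed.

Lemma parityT y : {in T, forall i, y i} -> parity y = 1.
Proof. by move=> yT; rewrite /parity big1 // => i /yT->. Qed.

Lemma parityP y : parity y = 1 \/ parity y = -1.
Proof. by rewrite /parity -signr_odd; case: odd; [right|left]. Qed.

(* For nonempty [T], the uniform distribution on the points with an even (or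
   odd, if [s]) number of zeros in [T]. *)
Definition parity_distr (s : bool) : {ffun cube I -> R} :=
  [ffun y => (1 + (-1) ^+ s * parity y) / #|cube I|%:R].

Lemma card_cube_gt0 : 0 < #|cube I|%:R :> R.
Proof. by rewrite ltr0n; apply/card_gt0P; exists [ffun=> true]. Qed.

(** Hence a function ignoring some item of [T] cannot tell the two values of [s] apart. *)
Lemma expect_parity_distr s f i : i \in T ->
  (forall y y', (forall k, k != i -> y k = y' k) -> f y = f y') ->
  expect (parity_distr s) f = (\sum_y f y) / #|cube I|%:R.
Proof.
move=> Ti fi; have S0 := sum_parity_eq0 Ti fi.
rewrite /expect (eq_bigr (fun y => f y / #|cube I|%:R +
    (-1) ^+ s / #|cube I|%:R * (parity y * f y))) => [|y _].
  by rewrite big_split /= -mulr_sumr S0 mulr0 addr0 mulr_suml.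
by rewrite ffunE; ring.
Qed.

Lemma is_distr_parity_distr s : T != set0 -> is_distr (parity_distr s).
Proof.
have N0 := card_cube_gt0.
case/set0Pn => i Ti; split=> [y|].
  rewrite ffunE divr_ge0 ?(ltW N0) //.
  by case: (parityP y) => ->; case: s; rewrite /= ?expr0 ?expr1; lra.
have -> : \sum_y parity_distr s y = expect (parity_distr s) (fun=> 1 : R).
  by apply: eq_bigr => y _; rewrite mulr1.
by rewrite (expect_parity_distr s Ti) // sumr_const divff // lt0r_neq0.
Qed.

End Parity.

(** * Frequencies of marginals, and implications forced by pair frequencies *)

Section Satisfies.
Variables (R : realType) (A : finType) (F : {set {set A}}).
Implicit Types (C U : {set A}) (z : cube A).

Lemma indic_restrict C U z : U \subset C ->
  indic (in_items C U) (restrict C z) = indic U z.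
Proof.
move=> /subsetP sUC; apply/forall_inP/forall_inP => [h i Ui|h i].
  by have := h (exist _ i (sUC i Ui)); rewrite inE ffunE; apply.
by rewrite inE ffunE; apply: h.
Qed.

Lemma proj_satisfies_marginal C theta (p : {ffun cube A -> R}) :
  satisfies F theta p -> proj_satisfies F theta (marginal C p).
Proof.
move=> satp U; rewrite inE => /andP[FU sUC]; rewrite -(satp U FU).
rewrite expect_marginal; apply: eq_bigr => z _ /=.
by rewrite indic_restrict.
Qed.

Lemma indic1 i z : indic [set i] z = z i.
Proof. by apply/forall_inP/idP => [-> //|zi j /set1P->]; rewrite ?inE. Qed.

Lemma indic2 i j z : indic [set i; j] z = z i && z j.
Proof.
apply/forall_inP/andP => [h|[zi zj] k /set2P[]-> //].
by split; apply: h; rewrite !inE eqxx ?orbT.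
Qed.

(* Both frequencies of a pair inside a common itemset are prescribed, so an
   implication holding almost surely under [p] also does under [q]. *)
Lemma satisfies_imply theta (p q : {ffun cube A -> R}) U i j :
  antimonotonic F -> satisfies F theta p -> satisfies F theta q ->
  is_distr q -> U \in F -> i \in U -> j \in U ->
  (forall z, p z != 0 -> z i -> z j) -> forall z, q z != 0 -> z i -> z j.
Proof.
move=> amF satp satq [q0 _] FU Ui Uj pij.
have F1 : [set i] \in F by apply: amF FU _; rewrite sub1set.
have F2 : [set i; j] \in F by apply: amF FU _; rewrite subUset !sub1set Ui.
have E (r : {ffun cube A -> R}) : satisfies F theta r ->
    \sum_z r z * (z i && ~~ z j)%:R = theta [set i] - theta [set i; j].
  move=> satr; rewrite -!satr // /expect -sumrB; apply: eq_bigr => z _.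
  rewrite indic1 indic2; case: (z i); case: (z j);
    by rewrite /= ?mulr1 ?mulr0 ?subrr ?subr0.
have : \sum_z q z * (z i && ~~ z j)%:R = 0.
  rewrite E // -(E p) //; apply: big1 => z _.
  have [->|/pij] := eqVneq (p z) 0; first by rewrite mul0r.
  by case: (z i) => [->//|_]; rewrite /= ?mulr0.
move=> /psumr_eq0P S0 z qz zi; apply/negPn/negP => zj.
have /eqP := S0 (fun z _ => mulr_ge0 (q0 z) (ler0n R _)) z isT.
by rewrite zi zj /= mulr1 (negPf qz).
Qed.

End Satisfies.

(** * Components outside [C] and their boundaries *)

Section Components.
Variables (A : finType) (F : {set {set A}}) (C : {set A}).
Implicit Types (x y : A) (U : {set A}).

Definition share x y := [exists U in F, (x \in U) && (y \in U)].

Definition adj x y := [&& x \notin C, y \notin C & share x y].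

Definition component x : {set A} := [set y | connect adj x y].

Definition boundary x : {set A} :=
  [set c in C | [exists b in component x, share b c]].

Lemma shareP x y :
  reflect (exists U, [/\ U \in F, x \in U & y \in U]) (share x y).
Proof.
apply: (iffP exists_inP) => [[U FU /andP[]]|[U [FU xU yU]]]; exists U => //.
by rewrite xU.
Qed.

Lemma adj_sym : symmetric adj.
Proof.
move=> x y; rewrite /adj andbCA; congr [&& _, _ & _].
by apply: eq_existsb => U; rewrite [(x \in U) && _]andbC.
Qed.

Lemma boundary_sub x : boundary x \subset C.
Proof. by apply/subsetP => c; rewrite inE => /andP[]. Qed.

(** It is the complement of [D] that is closed; as [adj] is symmetric, [D] is then a union of
    components. *)
Definition closed_under_adj (D : {set A}) :=
  forall x y, x \notin D -> adj x y -> y \notin D.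

Lemma disjoint_component (D : {set A}) x :
  closed_under_adj D -> x \notin D -> [disjoint D & component x].
Proof.
move=> clD xD; rewrite disjoint_sym disjoints_subset.
apply/subsetP => y; rewrite !inE => /connectP[s].
elim: s x xD => [|z s IH] x xD /= => [_ -> //|/andP[xz] zs].
exact: IH (clD _ _ xD xz) zs.
Qed.

Lemma closed_under_adj_component (D : {set A}) x :
  closed_under_adj D -> closed_under_adj (D :|: component x).
Proof.
move=> clD y z; rewrite !inE !negb_or => /andP[yD yB] yz.
rewrite (clD _ _ yD yz) /=; apply: contra yB => xz.
by apply: connect_trans xz _; apply: connect1; rewrite adj_sym.
Qed.

Lemma closed_under_adj_self : closed_under_adj C.
Proof. by move=> x y _ /and3P[]. Qed.

(** An item of [U] outside [C] is adjacent to [b], and one in [C] shares [U] with [b]. So each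
    frequency concerns either a set missing the component or one that redrawing it controls. *)
Lemma sub_component_boundary x U b : x \notin C -> U \in F ->
  b \in component x -> b \in U -> U \subset component x :|: boundary x.
Proof.
move=> xC FU bB bU; apply/subsetP => u uU; rewrite inE.
have bu : share b u by apply/shareP; exists U.
have [uC|uC] := boolP (u \in C).
  by apply/orP; right; rewrite inE uC; apply/exists_inP; exists b.
have bC : b \notin C.
  by rewrite (disjointFl (disjoint_component closed_under_adj_self xC) bB).
apply/orP; left; move: bB; rewrite !inE => /connect_trans; apply.
by apply: connect1; rewrite /adj bC uC.
Qed.

End Components.

(** * Boundaries of components for a safe set, and growth of entropy *)

Section Safe.
Variables (R : realType) (A : finType) (F : {set {set A}}) (C : {set A}).
Hypothesis amF : antimonotonic F.

(** By contradiction: [q false] and [q true] have the same frequencies on the projected family, yet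
    some [b] in [B] has positive frequency under [p0], and frequency 0 under any extension of
    [q true] satisfying the same [theta]. *)
Lemma safe_boundary x : safe R F C -> x \notin C ->
  boundary F C x = set0 \/ boundary F C x \in F.
Proof.
move=> safeC xC; have [->|T0] := eqVneq (boundary F C x) set0; first by left.
right; apply/negPn/negP => FT.
set T := boundary F C x in T0 FT; set B := component F C x.
have dCB : [disjoint C & B].
  exact: disjoint_component (@closed_under_adj_self _ F C) xC.
have sTC : T \subset C := boundary_sub F C x.
pose T' := in_items C T.
have T'0 : T' != set0.
  case/set0Pn: T0 => c cT; apply/set0Pn.
  by exists (exist _ c (subsetP sTC c cT)); rewrite inE.
pose q s : {ffun cube (items C) -> R} := parity_distr R T' s.
have dq s : is_distr (q s) by exact: is_distr_parity_distr.
pose phi (y : cube (items C)) : cube A :=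
  [ffun i => if i \in B then [forall j in T', y j] else unrestrict y i].
have phiK y : restrict C (phi y) = y.
  apply/ffunP => j; rewrite !ffunE (disjointFr dCB (valP j)).
  by rewrite -[RHS]unrestrictE ffunE.
pose p0 := push phi (q false).
have dp0 : is_distr p0 by exact: is_distr_push.
pose theta U : R := expect p0 (fun z => (indic U z)%:R).
have satp0 : satisfies F theta p0 by [].
have freq : frequencies F theta by exists p0.
have satq : proj_satisfies F theta (q true).
  move=> U; rewrite inE => /andP[FU sUC].
  (* Otherwise [T] would be a subset of a member of [F]. The item [c] is one that the indicator of
     [U] ignores. *)
  have [c cT cU] : exists2 c, c \in T & c \notin U.
    by apply/subsetPn; apply: contra FT => /(amF FU).
  pose c' : items C := exist _ c (subsetP sTC c cT).
  have cT' : c' \in T' by rewrite inE.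
  have Uc (y y' : cube (items C)) : (forall k, k != c' -> y k = y' k) ->
      (indic (in_items C U) y)%:R = (indic (in_items C U) y')%:R :> R.
    move=> yy'; congr (nat_of_bool _)%:R; apply: eq_forallb => k.
    have [kU|//] := boolP (k \in in_items C U); rewrite yy' //.
    by apply: contraNneq cU => kc; move: kU; rewrite inE kc.
  rewrite (expect_parity_distr true cT' Uc) -(expect_parity_distr false cT' Uc).
  rewrite /theta expect_push; apply: eq_bigr => y _ /=.
  by rewrite -(indic_restrict (phi y) sUC) phiK.
have [p1 [dp1 satp1 ext1]] := safeC theta freq (q true) (dq true) satq.
have p0_supp z : p0 z != 0 -> exists y, z = phi y.
  have [/existsP[y /eqP<-]|/existsPn noy] := boolP [exists y, phi y == z].
    by exists y.
  by rewrite ffunE big_pred0 ?eqxx // => y; apply/negbTE.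
(* By the choice of [phi], a one in [B] forces ones on [B] and [T] under [p0]; pair frequencies
   carry this over to [p1] within each itemset. *)
have imply U i j : U \in F -> i \in U -> j \in U -> i \in B ->
    (j \in B) || (j \in T) -> forall z, p1 z != 0 -> z i -> z j.
  move=> FU iU jU iB jBT.
  apply: (satisfies_imply amF satp0 satp1 dp1 FU iU jU) => z /p0_supp[y ->].
  rewrite !ffunE iB; case: ifP jBT => //= jB jT /forall_inP yT.
  have jC := subsetP sTC j jT.
  have /= := yT (exist _ j jC); rewrite inE => /(_ jT).
  by rewrite -unrestrictE ffunE.
have [b bB [c cT [V [FV bV cV]]]] : exists2 b, b \in B & exists2 c, c \in T &
    exists V, [/\ V \in F, b \in V & c \in V].
  case/set0Pn: T0 => c cT; have := cT.
  rewrite inE => /andP[_ /exists_inP[b bB]].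
  by case/shareP=> V HV; exists b => //; exists c => //; exists V.
(* The implications are chained along a path of [adj] from [b]. *)
have allB z : p1 z != 0 -> z b -> {in B, forall k, z k}.
  move=> pz zb k kB; have : connect (adj F C) b k.
    move: bB kB; rewrite !inE => xb xk; apply: connect_trans xk.
    by rewrite (sym_connect_sym (@adj_sym A F C)).
  case/connectP=> s; elim: s b bB zb {kB bV} => [|e s IH] b' b'B zb' /=.
    by move=> _ ->.
  move=> /andP[b'e es] kE; have eB : e \in B.
    by move: b'B; rewrite !inE => /connect_trans; apply; apply: connect1.
  apply: (IH e) => //; case/and3P: b'e => _ _ /shareP[W [FW b'W eW]].
  by apply: (imply W b' e); rewrite ?eB.
have nob z : p1 z != 0 -> ~~ z b.
  move=> pz; apply/negP => zb; have zB := allB z pz zb.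
  have zT : {in T, forall k, z k}.
    move=> k kT; have := kT; rewrite inE => /andP[_ /exists_inP[e eB]].
    case/shareP=> W [FW eW kW]; apply: (imply W e k) => //; last exact: zB.
    by rewrite kT orbT.
  (* All ones on [T] means parity 1, which the sign of [q true] cancels. *)
  have : q true (restrict C z) = 0.
    rewrite ffunE parityT ?expr1 ?mulN1r ?subrr ?mul0r //.
    by move=> j; rewrite inE ffunE => /zT.
  rewrite -ext1 => mz; have := le_marg C z dp1; rewrite /marg mz.
  by rewrite le_eqVlt (negPf pz) /= ltNge (proj1 dp1).
have Fb : [set b] \in F by apply: amF FV _; rewrite sub1set.
have : expect p1 (fun z => (indic [set b] z)%:R) = 0.
  rewrite /expect big1 // => z _; rewrite indic1.
  by have [->|/nob/negPf->] := eqVneq (p1 z) 0; rewrite ?mul0r ?mulr0.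
rewrite satp1 // /theta expect_push => /eqP; apply/negP; rewrite gt_eqF //.
(* Under [q false] the all-ones point has mass 2 over the size of the cube, and [phi] sets [b] to
   one there. *)
rewrite /expect (bigD1 [ffun=> true]) //= ltr_pwDl //; last first.
  by apply: sumr_ge0 => y _; rewrite mulr_ge0 ?(proj1 (dq false)).
have phib : phi [ffun=> true] b.
  by rewrite ffunE bB; apply/forall_inP => j _; rewrite ffunE.
rewrite indic1 phib mulr1.
rewrite ffunE parityT => [|j _]; last by rewrite ffunE.
by rewrite expr0 mulr1 divr_gt0 ?card_cube_gt0 //; lra.
Qed.

(** Induction on the number of items outside [D]: each round redraws a whole component from [p] and
    adds it to [D], never lowering the entropy gap between [q] and [p] on [D]. *)
Lemma entropy_growth theta (p : {ffun cube A -> R}) (D : {set A})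
    (q : {ffun cube A -> R}) :
  safe R F C -> is_distr p -> satisfies F theta p ->
  C \subset D -> closed_under_adj F C D ->
  is_distr q -> satisfies F theta q ->
  exists q', [/\ is_distr q', satisfies F theta q' &
    entropy_on D q - entropy_on D p <= entropy q' - entropy p].
Proof.
move=> safeC dp satp; move: {2}_.+1 (ltnSn #|~: D|) => n.
elim: n D q => // n IH D q ltn sCD clD dq satq.
have [->|] := eqVneq D setT.
  by exists q; split=> //; rewrite !entropy_onT.
rewrite -subTset => /subsetPn[x _ xD].
have xC : x \notin C by apply: contra xD; apply/subsetP.
set B := component F C x; set T := boundary F C x.
have dDB : [disjoint D & B] := disjoint_component clD xD.
have sTC : T \subset C := boundary_sub F C x.
have sTD := subset_trans sTC sCD.
have dBT : [disjoint B & T] by rewrite disjoint_sym (disjointWl sTD).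
(* If [T] is in [F], so are its subsets, and their frequencies fix the marginal. If [T] is empty,
   the only moment is that of the empty itemset, which is 1. *)
have eqT : marginal T p = marginal T q.
  apply: marginal_eq_moments => U sUT.
  have [T0|FT] := safe_boundary safeC xC.
    have -> : U = set0 by apply/eqP; rewrite -subset0 -T0.
    have E0 r : is_distr r -> expect r (fun z => (indic set0 z)%:R) = 1 :> R.
      move=> [_ r1]; rewrite -[RHS]r1; apply: eq_bigr => z _.
      have -> : indic set0 z by apply/forall_inP => i; rewrite inE.
      by rewrite mulr1.
    by rewrite !E0.
  by have FU := amF FT sUT; rewrite satp ?satq.
have dr := is_distr_resample dBT dp dq eqT.
(* Itemsets missing [B] keep their frequency from [q]; the others lie in [B :|: T] and take it from
   [p]. *)
have satr : satisfies F theta (resample B T p q).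
  move=> U FU; have [dUB|/pred0Pn[b /andP[/= bU bB]]] := boolP [disjoint U & B].
    rewrite -(satq U FU); apply: (@expect_local _ _ (~: B)).
      by apply: local_indic; rewrite -disjoints_subset.
    by apply: marg_inj => z; apply: marg_resampleC.
  rewrite -(satp U FU); apply: (@expect_local _ _ (B :|: T)).
    by apply: local_indic; apply: sub_component_boundary bB bU.
  exact: marg_resampleBT.
have [|||q' [dq' satq' le_q']] := IH (D :|: B) (resample B T p q) _ _ _ dr satr.
- rewrite ltnS in ltn; apply: leq_trans ltn; apply: proper_card.
  rewrite properC properEneq subsetUl andbT.
  apply: contra xD => /eqP->; rewrite inE; apply/orP; right.
  by rewrite inE connect0.
- exact: subset_trans sCD (subsetUl _ _).
- exact: closed_under_adj_component.
exists q'; split=> //; apply: le_trans le_q'.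
by have := entropy_on_resample dBT dp dq eqT dDB sTD; lra.
Qed.

End Safe.

Theorem theorem5 (R : realType) (A : finType) (F : {set {set A}})
    (theta : {set A} -> R) (C : {set A})
    (pME : {ffun cube A -> R}) (qME : {ffun cube (items C) -> R}) :
  antimonotonic F ->
  frequencies F theta ->
  safe R F C ->
  is_max_entropy (satisfies F theta) pME ->
  is_max_entropy (proj_satisfies F theta) qME ->
  qME = marginal C pME.
Proof.
move=> amF freq safeC [dp satp maxp] maxq; have [dq satq maxq'] := maxq.
apply: is_max_entropy_uniq maxq _ => [p' q' satp' satq' U FU|].
  rewrite -[RHS](_ : (theta U + theta U) / 2 = _); last by field.
  rewrite -{1}(satp' U FU) -(satq' U FU) /expect -big_split mulr_suml.
  by apply: eq_bigr => y _; rewrite ffunE /=; field.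
split; [exact: is_distr_marginal|exact: proj_satisfies_marginal|].
move=> q' dq' satq''.
apply: le_trans (maxq' _ dq' satq'') _.
(* Growing from [D = C], the gap between [qME] and the marginal of [pME] is at most
   [entropy p2 - entropy pME], which is not positive. *)
have [p1 [dp1 satp1 ext1]] := safeC theta freq qME dq satq.
have [p2 [dp2 satp2]] := entropy_growth amF safeC dp satp (subxx C)
  (@closed_under_adj_self _ F C) dp1 satp1.
by have := maxp p2 dp2 satp2; rewrite !entropy_onE ext1; lra.
Qed.
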